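(* There is a positive constant $\gamma$ such that for every integer $t \geq 30$ and every integer $m \leq \gamma 2^t$, every $(m,m,m,m)$-cube $A$ of order $n=2^t$ is avoidable.
   Context: A cube of order $n$ is an $n\times n\times n$ array of cells $(i,j,k)$, $i,j,k\in[n]=\{1,\dots,n\}$. A line of a cube is obtained by fixing two coordinates and letting the third vary: a row is $\{(i,j^*,k): j^*\in[n]\}$, a column is $\{(i^*,j,k): i^*\in[n]\}$, a file is $\{(i,j,k^* ):k^*\in[n]\}$. An $(m,m,m,m)$-cube of order $n$ is a cube $A$ of order $n$ in which each cell $(i,j,k)$ contains a subset $A(i,j,k)\subseteq[n]$ such that: every cell contains at most $m$ symbols, and each symbol occurs at most $m$ times in each row, at most $m$ times in each column, and at most $m$ times in each file. A Latin cube $L$ of order $n$ is a cube of order $n$ whose every cell contains one symbol $L(i,j,k)\in[n]$ such that each symbol appears exactly once in each row, column and file. $A$ is avoidable if there is a Latin cube $L$ of order $n$ with $L(i,j,k)\notin A(i,j,k)$ for all $i,j,k\in[n]$. *)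

(* Defs.v *)
From mathcomp Require Import all_boot all_order all_algebra.
Set Implicit Arguments. Unset Strict Implicit. Unset Printing Implicit Defensive.

Definition cube (n : nat) := 'I_n -> 'I_n -> 'I_n -> {set 'I_n}.

Definition mmmm_cube (n m : nat) (A : cube n) : Prop :=
  (forall i j k, #|A i j k| <= m)%N /\
  (forall s i k, #|[set j | s \in A i j k]| <= m)%N /\
  (forall s j k, #|[set i | s \in A i j k]| <= m)%N /\
  (forall s i j, #|[set k | s \in A i j k]| <= m)%N.

Definition latin_cube (n : nat) (L : 'I_n -> 'I_n -> 'I_n -> 'I_n) : Prop :=
  (forall s i k, #|[set j | L i j k == s]| = 1)%N /\
  (forall s j k, #|[set i | L i j k == s]| = 1)%N /\
  (forall s i j, #|[set k | L i j k == s]| = 1)%N.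

Definition avoidable (n : nat) (A : cube n) : Prop :=
  exists L, latin_cube L /\ forall i j k, L i j k \notin A i j k.

(* Main.v *)
Require Import Defs.
From mathcomp Require Import all_boot all_order all_algebra.
From mathcomp Require Import zify ring.
Import Order.TTheory GRing.Theory Num.Theory.
Set Implicit Arguments.
Unset Strict Implicit.
Unset Printing Implicit Defensive.

(* A Latin cube is the same thing as a set of quadruples (row, column, file,
   symbol) that meets every axis-parallel line exactly once, and the argument
   works for such sets in any number of coordinates.  If the levels are pairs
   (x, y) with x in a finite abelian group, then a Latin set may be chosen
   independently in every block x = b with b summing to 0, and together these
   form a Latin set.

   When x is a bit and the two members of each pair are swapped or not by
   independent coin flips, every forbidden line is split almost evenly
   (Chernoff).  So the density m / 2 ^ t up to which everything is avoidable at
   order 2 ^ t loses at most a factor 1 - 1 / (t + 1) ^ 2 when t grows by one.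
   The product of these factors converges, hence it is enough to start from one
   order 2 ^ t with m large compared to a polynomial in t.

   For that, split a large order into blocks of constant size by random shifts.
   If m is a small power of the order, then with positive probability the
   forbidden quadruples of every block project to at most half of the levels in
   each coordinate, and such a block is avoidable: relabel its levels by pairs
   (bit, y) such that all forbidden quadruples have bits summing to 1. *)

Lemma leq_exp2rW a b n : a <= b -> a ^ n <= b ^ n.
Proof. by case: n => // n leab; rewrite leq_exp2r. Qed.

Lemma card_sum_mem {T : finType} (A : {set T}) : #|A| = \sum_x (x \in A).
Proof.
by rewrite -sum1_card big_mkcond; apply: eq_bigr => x _; case: in_mem.
Qed.

Lemma leq_card_preimset {T T' : finType} (f : T -> T') (A : {set T'}) :
  injective f -> #|f @^-1: A| <= #|A|.
Proof.
move=> f_inj; rewrite -(card_imset _ f_inj); apply/subset_leq_card/subsetP.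
by move=> _ /imsetP[x + ->]; rewrite inE.
Qed.

Lemma leq_card_bigcup {I T : finType} (P : pred I) (F : I -> {set T}) :
  #|\bigcup_(i | P i) F i| <= \sum_(i | P i) #|F i|.
Proof.
elim/big_rec2: _ => [|i n A _ leA]; first by rewrite cards0.
by rewrite (leq_trans (leq_card_setU _ _)) // leq_add2l.
Qed.

Lemma eq_card_bij {T T' : finType} :
  #|T| = #|T'| -> exists f : T -> T', bijective f.
Proof.
move=> eqTT'; exists (fun x => enum_val (cast_ord eqTT' (enum_rank x))).
exists (fun y => enum_val (cast_ord (esym eqTT') (enum_rank y))) => z.
  by rewrite enum_valK cast_ordK enum_rankK.
by rewrite enum_valK cast_ordKV enum_rankK.
Qed.

Lemma bij_preimset_sub {T : finType} (X Y : {set T}) :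
  #|X| <= #|Y| -> exists2 f : T -> T, bijective f & f @^-1: X \subset Y.
Proof.
move=> leXY; pose listing (Z : {set T}) := enum Z ++ enum (~: Z).
have mem_listing Z x : x \in listing Z by rewrite mem_cat !mem_enum inE orbN.
have uniq_listing Z : uniq (listing Z).
  rewrite cat_uniq !enum_uniq andbT; apply/hasPn => x.
  by rewrite !mem_enum inE.
have size_listing Z : size (listing Z) = #|T|.
  rewrite -(card_uniqP (uniq_listing Z)) -cardsT; apply: eq_card => x.
  by rewrite mem_listing inE.
pose f y := nth y (listing X) (index y (listing Y)).
have ltT y Z Z' : index y (listing Z) < size (listing Z').
  by rewrite size_listing -(size_listing Z) index_mem.
exists f.
  apply: injF_bij => y y'; rewrite /f (set_nth_default y') ?ltT // => /eqP.
  by rewrite nth_uniq ?ltT // => /eqP/(index_inj y); apply.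
apply/subsetP => y; rewrite inE; apply: contraTT => Yy.
have ge_y : size (enum X) <= index y (listing Y).
  by rewrite index_cat mem_enum (negPf Yy) -!cardE (leq_trans leXY) ?leq_addr.
rewrite /f nth_cat ltnNge ge_y /= -in_setC -mem_enum mem_nth //.
by rewrite -(ltn_add2l (size (enum X))) subnKC // -size_cat ltT.
Qed.

Section LatinSets.

Variable I : finType.
Implicit Types U V B H : finType.

Definition line U i (p : {ffun I -> U}) (u : U) : {ffun I -> U} :=
  [ffun j => if j == i then u else p j].

Definition trace U (A : {set {ffun I -> U}}) i p : {set U} := line i p @^-1: A.

Definition codegree_le U m (A : {set {ffun I -> U}}) : Prop :=
  forall i p, #|trace A i p| <= m.

(* For [I := 'I_4] these are the graphs of Latin cubes, the row, column, file
   and symbol playing symmetric roles. *)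
Definition latin U (L : {set {ffun I -> U}}) : Prop :=
  forall i p, #|trace L i p| = 1.

Definition latin_avoidable U (A : {set {ffun I -> U}}) : Prop :=
  exists2 L, latin L & [disjoint L & A].

Definition all_avoidable U m : Prop :=
  forall A : {set {ffun I -> U}}, codegree_le m A -> latin_avoidable A.

Lemma line_id U i (p : {ffun I -> U}) : line i p (p i) = p.
Proof. by apply/ffunP => j; rewrite ffunE; case: eqP => // ->. Qed.

Lemma line_line U i (p : {ffun I -> U}) u v :
  line i (line i p u) v = line i p v.
Proof. by apply/ffunP => j; rewrite !ffunE; case: eqP. Qed.

Lemma line_eq U i (p : {ffun I -> U}) u : line i p u i = u.
Proof. by rewrite ffunE eqxx. Qed.

Lemma sum_card_trace U (E : {set {ffun I -> U}}) i :
  \sum_p #|trace E i p| = #|U| * #|E|.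
Proof.
transitivity (\sum_p \sum_u (line i p u \in E)).
  apply: eq_bigr => p _; rewrite card_sum_mem.
  by apply: eq_bigr => u _; rewrite inE.
pose swap (a : {ffun I -> U} * U) := (line i a.1 a.2, a.1 i).
have swapK : involutive swap.
  by case=> p u; rewrite /swap /= line_line line_id line_eq.
rewrite pair_bigA (reindex_inj (inv_inj swapK)) /=.
rewrite -(pair_bigA _ (fun p u => line i (line i p u) (p i) \in E : nat)).
rewrite exchange_big -sum_nat_const; apply: eq_bigr => u _.
by rewrite card_sum_mem; apply: eq_bigr => p _; rewrite line_line line_id.
Qed.

Lemma card_le_trace U (E : {set {ffun I -> U}}) i m n :
  (forall p, #|trace E i p| * n <= m * #|U|) ->
  #|E| * n <= m * #|{ffun I -> U}|.
Proof.
move=> leE; have [->|/set0Pn[p _]] := eqVneq E set0; first by rewrite cards0.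
have U0 : 0 < #|U| by apply/card_gt0P; exists (p i).
rewrite -(leq_pmul2l U0) mulnA -(sum_card_trace E i) big_distrl /=.
rewrite mulnCA [_ * #|_|]mulnC mulnCA -sum_nat_const.
by apply: leq_sum => p' _; apply: leE.
Qed.

Lemma all_avoidableW U m n : m <= n -> all_avoidable U n -> all_avoidable U m.
Proof.
by move=> lemn avoid A leA; apply: avoid => i p; apply: leq_trans lemn.
Qed.

Definition relabel U V (f : I -> V -> U) (p : {ffun I -> V}) : {ffun I -> U} :=
  [ffun i => f i (p i)].

Lemma relabel_line U V (f : I -> V -> U) i p v :
  relabel f (line i p v) = line i (relabel f p) (f i v).
Proof. by apply/ffunP => j; rewrite !ffunE; case: eqP => // ->. Qed.

Lemma trace_relabel U V (f : I -> V -> U) (A : {set {ffun I -> U}}) i p :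
  trace (relabel f @^-1: A) i p = f i @^-1: trace A i (relabel f p).
Proof. by apply/setP => v; rewrite !inE relabel_line. Qed.

Lemma codegree_le_relabel U V (f : I -> V -> U) m (A : {set {ffun I -> U}}) :
  (forall i, injective (f i)) -> codegree_le m A ->
  codegree_le m (relabel f @^-1: A).
Proof.
move=> f_inj leA i p; rewrite trace_relabel.
exact: leq_trans (leq_card_preimset _ (f_inj i)) (leA i _).
Qed.

Lemma latin_relabel U V (f : I -> V -> U) (L : {set {ffun I -> U}}) :
  (forall i, bijective (f i)) -> latin L -> latin (relabel f @^-1: L).
Proof.
move=> f_bij latL i p; rewrite trace_relabel on_card_preimset ?latL //.
exact: onW_bij.
Qed.

Lemma latin_avoidable_relabel U V (f : I -> V -> U) (A : {set {ffun I -> U}}) :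
  (forall i, bijective (f i)) -> latin_avoidable (relabel f @^-1: A) ->
  latin_avoidable A.
Proof.
move=> f_bij [L latL disjL].
have /fin_all_exists2[g fK gK] i : exists2 g, cancel (f i) g & cancel g (f i).
  by case: (f_bij i) => g; exists g.
exists (relabel g @^-1: L).
  by apply: latin_relabel latL => i; exists (f i).
apply/pred0P => p /=; rewrite inE; apply/negP => /andP[gpL pA].
have /= := pred0P disjL (relabel g p); rewrite gpL inE.
suff -> : relabel f (relabel g p) = p by rewrite pA.
by apply/ffunP => i; rewrite !ffunE gK.
Qed.

Lemma all_avoidable_card U V m :
  #|U| = #|V| -> all_avoidable U m -> all_avoidable V m.
Proof.
move=> /eq_card_bij[f f_bij] avoidU A leA.
apply: (@latin_avoidable_relabel _ _ (fun=> f)) => //; apply: avoidU.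
by apply: codegree_le_relabel => // _; apply: bij_inj.
Qed.

Definition zero_sum (B : finZmodType) : {set {ffun I -> B}} :=
  [set p : {ffun I -> B} | \sum_i p i == 0]%R.

Lemma latin_zero_sum (B : finZmodType) : latin (zero_sum B).
Proof.
move=> i p; rewrite -(cards1 (- \sum_(j | j != i) p j)%R).
apply: eq_card => x; rewrite !inE (bigD1 i) //= line_eq -addr_eq0.
congr (_ + _ == _)%R.
by apply: eq_bigr => j /negPf ji; rewrite ffunE ji.
Qed.

Lemma latin_avoidable0 U : latin_avoidable (set0 : {set {ffun I -> U}}).
Proof.
have [U0|U0] := posnP #|U|.
  exists set0; last by rewrite disjoints_subset sub0set.
  by move=> i p; have := card0_eq U0 (p i).
have [|f f_bij] := @eq_card_bij U 'I_#|U|.-1.+1.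
  by rewrite card_ord prednK.
exists (relabel (fun=> f) @^-1: zero_sum _).
  by apply: latin_relabel => //; apply: latin_zero_sum.
by rewrite disjoint_sym disjoints_subset sub0set.
Qed.

Lemma all_avoidable0 (i : I) U : all_avoidable U 0.
Proof.
move=> A leA; suff -> : A = set0 by apply: latin_avoidable0.
apply/setP => p; rewrite inE; apply/negP => pA.
have := leA i p; rewrite leqn0 cards_eq0 => /eqP/setP/(_ (p i)).
by rewrite !inE line_id pA.
Qed.

Section Blocks.

Variables B H : finType.
Implicit Types (A : {set {ffun I -> B * H}}) (b : {ffun I -> B}).

Definition pair_point b (h : {ffun I -> H}) : {ffun I -> B * H} :=
  [ffun i => (b i, h i)].

Definition block A b : {set {ffun I -> H}} := pair_point b @^-1: A.

Definition fiber (D : {set B * H}) x : {set H} := pair x @^-1: D.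

Lemma line_pair_point i b h x y :
  line i (pair_point b h) (x, y) = pair_point (line i b x) (line i h y).
Proof. by apply/ffunP => j; rewrite !ffunE; case: eqP. Qed.

Lemma trace_block A b i h :
  trace (block A b) i h = fiber (trace A i (pair_point b h)) (b i).
Proof. by apply/setP => y; rewrite !inE line_pair_point line_id. Qed.

Lemma latin_avoidable_blocks A (L : {set {ffun I -> B}}) :
  latin L -> {in L, forall b, latin_avoidable (block A b)} -> latin_avoidable A.
Proof.
move=> latL avoidA.
have /fin_all_exists[M MP] b :
    exists M, b \in L -> latin M /\ [disjoint M & block A b].
  case: (boolP (b \in L)) => [/avoidA[M latM disjM]|_]; last by exists set0.
  by exists M.
pose fsts := relabel (fun=> @fst B H); pose snds := relabel (fun=> @snd B H).
have pairK p : pair_point (fsts p) (snds p) = p.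
  by apply/ffunP => i; rewrite !ffunE -surjective_pairing.
exists [set p | (fsts p \in L) && (snds p \in M (fsts p))]; last first.
  apply/pred0P => p /=; rewrite inE; apply/negP => /andP[/andP[pL pM] pA].
  have [_ /pred0P/(_ (snds p))/=] := MP _ pL.
  by rewrite pM inE pairK pA.
move=> i p; have /eqP/cards1P[x xP] := latL i (fsts p).
have Lx : line i (fsts p) x \in L.
  by have := set11 x; rewrite -xP inE.
have /eqP/cards1P[y yP] := (MP _ Lx).1 i (snds p).
rewrite -(cards1 (x, y)); apply: eq_card => -[x' y'].
rewrite !inE xpair_eqE -(in_set1 _ x) -(in_set1 _ y) -xP -yP !inE.
rewrite /fsts /snds !relabel_line -/fsts -/snds /=.
case: (boolP (_ \in L)) => //= Lx'.
by have /set1P-> : x' \in [set x] by rewrite -xP inE.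
Qed.

Lemma card_sum_fiber (D : {set B * H}) : #|D| = \sum_x #|fiber D x|.
Proof.
rewrite card_sum_mem (eq_bigr (fun a => (a.1, a.2) \in D : nat)); last by case.
rewrite -(pair_bigA _ (fun x y => (x, y) \in D : nat)).
apply: eq_bigr => x _; rewrite card_sum_mem.
by apply: eq_bigr => y _; rewrite inE.
Qed.

End Blocks.

Section Twists.

Variables (B : finZmodType) (H : finType).

Definition twist (r : {ffun H -> B}) (a : B * H) : B * H :=
  ((a.1 + r a.2)%R, a.2).

Lemma twist_bij r : bijective (twist r).
Proof.
by exists (fun a => ((a.1 - r a.2)%R, a.2)) => -[x y];
  rewrite /twist /= ?addrK ?subrK.
Qed.

Definition twist_point (r : I -> {ffun H -> B}) :=
  relabel (fun i => twist (r i)).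

Lemma latin_avoidable_twist r (A : {set {ffun I -> B * H}}) :
  (forall b, latin_avoidable (block (twist_point r @^-1: A) b)) ->
  latin_avoidable A.
Proof.
move=> avoidA; apply: (@latin_avoidable_relabel _ _ (fun i => twist (r i))).
  by move=> i; apply: twist_bij.
by apply: (latin_avoidable_blocks (@latin_zero_sum B)) => b _; apply: avoidA.
Qed.

End Twists.
End LatinSets.

Lemma union_bound {W E : finType} (bad : E -> {set W}) p q :
    0 < #|W| -> #|E| * p < q -> (forall e, #|bad e| * q <= p * #|W|) ->
  exists w, forall e, w \notin bad e.
Proof.
move=> W0 lt_q le_bad.
have /subsetPn[w _ wP] : ~~ ([set: W] \subset \bigcup_e bad e).
  apply/negP => /subset_leq_card; rewrite cardsT => leW.
  have: #|W| * q <= #|E| * p * #|W|.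
    have {}leW := leq_trans leW (leq_card_bigcup _ _).
    apply: leq_trans (leq_mul leW (leqnn q)) _.
    by rewrite big_distrl -mulnA -sum_nat_const; apply: leq_sum.
  by rewrite mulnC leq_pmul2r // leqNgt lt_q.
by exists w => e; apply: contra wP => we; apply/bigcupP; exists e.
Qed.

Lemma markov_card {W : finType} (bad : {set W}) (f : W -> nat) N S :
  {in bad, forall w, N <= f w} -> \sum_w f w <= S -> #|bad| * N <= S.
Proof.
move=> le_f; apply: leq_trans.
rewrite -sum_nat_const big_mkcond leq_sum // => w _.
by case: ifP => // /le_f.
Qed.

Lemma bernoulli_succ q n : q ^ n * (q + n) <= q * q.+1 ^ n.
Proof. by elim: n => [|n IH]; rewrite ?expnS; nia. Qed.

Lemma bernoulli_pred q n : q ^ n * (q - n) <= q * q.-1 ^ n.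
Proof.
elim: n => [|n IH]; first by rewrite !expn0; lia.
rewrite !expnS; move: (q ^ n) (q.-1 ^ n) IH => a b IH.
have [lt_nq|le_qn] := ltnP n q; first by nia.
by rewrite (eqP (leqW le_qn)) muln0.
Qed.

Lemma exp2_mul_leq_expn_succ q u n :
  0 < q -> q * u <= n -> 2 ^ u * q ^ n <= q.+1 ^ n.
Proof.
move=> q0 /subnKC<-; rewrite !expnD mulnA leq_mul ?leq_exp2rW //.
rewrite !expnM -expnMn leq_exp2rW //.
by have := bernoulli_succ q q; nia.
Qed.

Lemma expn_leq_exp2_mul_pred q h v n :
  0 < q -> 2 * h <= q -> n <= h * v -> q ^ n <= 2 ^ v * q.-1 ^ n.
Proof.
move=> q0 le_hq; elim: v n => [|v IH] n le_n.
  by have -> : n = 0 by lia.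
have half l : l <= h -> q ^ l <= 2 * q.-1 ^ l.
  by move=> le_lh; have := bernoulli_pred q l; nia.
rewrite -(subnKC (geq_minl n h)) !expnD expnS mulnACA.
by rewrite leq_mul ?half ?geq_minr ?IH //; lia.
Qed.

Section CoinFlips.

Variables (H : finType) (D : {set bool * H}) (b : bool).

Let heads (c : {ffun H -> bool}) := #|fiber (twist c @^-1: D) b|.
Let tails (c : {ffun H -> bool}) := #|fiber (twist c @^-1: D) (~~ b)|.

Lemma heads_tails c : heads c + tails c = #|D|.
Proof.
rewrite -(on_card_preimset (onW_bij _ (twist_bij c))) card_sum_fiber big_bool.
by rewrite /heads /tails; case: b; rewrite //= addnC.
Qed.

(* The exponential moment of the Chernoff bound, scaled by [q ^ #|D|]: the
   weight is [1 + 1/q] per head and [1 - 1/q] per tail. *)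
Lemma sum_coin_weight q :
  0 < q ->
  \sum_c q.+1 ^ heads c * q.-1 ^ tails c <= 2 ^ #|H| * q ^ #|D|.
Proof.
move=> q0; pose w x y :=
  q.+1 ^ ((b + y, x)%R \in D) * q.-1 ^ ((~~ b + y, x)%R \in D).
rewrite (eq_bigr (fun c : {ffun H -> bool} => \prod_x w x (c x))); last first.
  move=> c _; rewrite big_split /= -!expn_sum /heads /tails !card_sum_mem.
  by congr (_ ^ _ * _ ^ _); apply: eq_bigr => x _; rewrite !inE.
rewrite -bigA_distr_bigA card_sum_fiber big_bool !card_sum_mem -big_split /=.
rewrite expn_sum -prod_nat_const -big_split leq_prod // => x _ /=.
rewrite big_bool /w !inE; case: b => /=;
  by case: (_ \in D) (_ \in D) => [] []; rewrite /= ?(expn0, expn1); nia.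
Qed.

(* [(1 + 1/q) ^ x (1 - 1/q) ^ z = (1 - 1/q ^ 2) ^ z (1 + 1/q) ^ (x - z)], where
   the factors are at least [2 ^ -v] and [2 ^ (v + w)]. *)
Lemma chernoff_weight_ge q h v w x z :
    0 < q -> 2 * h <= q ^ 2 -> z <= h * v -> z + q * (v + w) <= x ->
  2 ^ w * q ^ (x + z) <= q.+1 ^ x * q.-1 ^ z.
Proof.
move=> q0 le_h le_z le_x.
have [n def_x] : exists n, x = z + n by exists (x - z); lia.
have le_n : q * (v + w) <= n by lia.
rewrite -(@leq_pmul2l (2 ^ v)) ?expn_gt0 // mulnA -expnD.
have -> : q ^ (x + z) = (q ^ 2) ^ z * q ^ n.
  by rewrite -expnM -expnD; congr (q ^ _); lia.
have -> : q.+1 ^ x * q.-1 ^ z = (q ^ 2).-1 ^ z * q.+1 ^ n.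
  have -> : (q ^ 2).-1 = q.+1 * q.-1 by rewrite expnS expn1; nia.
  by rewrite def_x expnMn !expnD; ring.
rewrite mulnCA [leqRHS]mulnA leq_mul //; last exact: exp2_mul_leq_expn_succ.
by apply: expn_leq_exp2_mul_pred le_z => //; rewrite expn_gt0 q0.
Qed.

Lemma card_many_heads q h v w m :
    0 < q -> 2 * h <= q ^ 2 -> m <= h * v -> #|D| + q * (v + w) <= 2 * m ->
  #|[set c | m < heads c]| * 2 ^ w <= #|{ffun H -> bool}|.
Proof.
move=> q0 le_h le_m le_D; rewrite card_ffun card_bool.
have qD0 : 0 < q ^ #|D| by rewrite expn_gt0 q0.
rewrite -(leq_pmul2r qD0) -mulnA.
apply: markov_card (sum_coin_weight q0) => c; rewrite inE => lt_m.
have htD := heads_tails c; rewrite -htD.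
by apply: (chernoff_weight_ge (h := h) (v := v)) => //; lia.
Qed.

End CoinFlips.

Lemma exists_balanced_twist {E H : finType} (D : E -> {set bool * H})
    q h v w m n :
    0 < q -> 2 * h <= q ^ 2 -> n <= h * v -> m + q * (v + w) <= 2 * n ->
    #|E| * 2 < 2 ^ w -> (forall e, #|D e| <= m) ->
  exists c, forall e b, #|fiber (twist c @^-1: D e) b| <= n.
Proof.
move=> q0 le_h le_n le_m lt_w leD.
pose bad (a : E * bool) := [set c | n < #|fiber (twist c @^-1: D a.1) a.2|].
have [|||c cP] := union_bound (bad := bad) (p := 1) (q := 2 ^ w).
- by rewrite card_ffun card_bool expn_gt0.
- by rewrite muln1 card_prod card_bool.
- move=> [e b]; rewrite mul1n; apply: (card_many_heads b q0 le_h le_n).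
  by apply: leq_trans le_m; rewrite leq_add2r leD.
by exists c => e b; have := cP (e, b); rewrite inE -leqNgt.
Qed.

Lemma card_fiber_sup {B : finZmodType} {H : finType} (D : {set B * H}) b
    (J : {set H}) :
  #|[set r | J \subset fiber (twist r @^-1: D) b]| * #|B| ^ #|J|
    <= #|D| ^ #|J| * #|{ffun H -> B}|.
Proof.
pose F x := if x \in J then [pred y | (b + y, x)%R \in D] else predT.
have le_F : #|[set r | J \subset fiber (twist r @^-1: D) b]| <= #|family F|.
  apply/subset_leq_card/subsetP => r; rewrite inE => /subsetP subJ.
  apply/familyP => x; rewrite /F; case: ifP => // /subJ.
  by rewrite !inE.
apply: leq_trans (leq_mul le_F (leqnn _)) _.
have -> : #|{ffun H -> B}| = #|B| ^ (#|H| - #|J|) * #|B| ^ #|J|.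
  by rewrite card_ffun -expnD subnK ?max_card.
rewrite mulnA leq_mul2r; apply/orP; right; rewrite card_family foldrE big_map.
rewrite big_enum (bigID (mem J)) /= leq_mul //.
  rewrite -prod_nat_const leq_prod // => x Jx; rewrite /F Jx.
  have shift_inj : injective (fun y => (b + y, x)%R) by move=> y y' [/addrI].
  rewrite -(card_imset _ shift_inj).
  apply/subset_leq_card/subsetP => _ /imsetP[y + ->].
  by rewrite inE.
rewrite (eq_bigr (fun=> #|B|)); last by move=> x /negPf Jx; rewrite /F Jx.
rewrite prod_nat_const leq_pexp2l //.
  by apply/card_gt0P; exists 0%R.
by rewrite -(cardC J) addKn.
Qed.

Lemma card_large_fiber {B : finZmodType} {H : finType} (D : {set B * H}) b g :
  #|[set r | g <= #|fiber (twist r @^-1: D) b|]| * #|B| ^ g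
    <= 'C(#|H|, g) * #|D| ^ g * #|{ffun H -> B}|.
Proof.
pose sup (J : {set H}) :=
  [set r : {ffun H -> B} | J \subset fiber (twist r @^-1: D) b].
have sub : [set r | g <= #|fiber (twist r @^-1: D) b|]
    \subset \bigcup_(J : {set H} | #|J| == g) sup J.
  apply/subsetP => r; rewrite inE => /card_geqP[s [uniq_s size_s sub_s]].
  apply/bigcupP; exists [set x in s].
    by rewrite cardsE (card_uniqP uniq_s) size_s.
  by rewrite inE; apply/subsetP => x; rewrite inE => /sub_s.
have := leq_trans (subset_leq_card sub) (leq_card_bigcup _ _).
move=> /leq_mul/(_ (leqnn (#|B| ^ g)))/leq_trans; apply.
rewrite big_distrl -card_draws -mulnA -sum_nat_const /=.
under [leqRHS]eq_bigl do rewrite inE.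
by apply: leq_sum => J /eqP <-; apply: card_fiber_sup.
Qed.

Section Avoidance.

Variable I : finType.

Lemma all_avoidable_halving (H : finType) m m' q h v w :
    0 < q -> 2 * h <= q ^ 2 -> m' <= h * v -> m + q * (v + w) <= 2 * m' ->
    #|{ffun I -> bool * H}| * 2 < 2 ^ w -> all_avoidable I H m' ->
  all_avoidable I (bool * H)%type m.
Proof.
move=> q0 le_h le_m' le_m lt_w avoidH A leA.
have /fin_all_exists[c cP] i : exists c : {ffun H -> bool}, forall p b,
    #|fiber (twist c @^-1: trace A i p) b| <= m'.
  exact: exists_balanced_twist q0 le_h le_m' le_m lt_w (leA i).
apply: (latin_avoidable_twist (r := c)) => b; apply: avoidH => i y.
rewrite trace_block trace_relabel.
exact: cP.
Qed.

Definition projection (U : finType) i (A : {set {ffun I -> U}}) : {set U} :=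
  [set p i | p : {ffun I -> U} in A].

(* Moving the projections into the classes [b], 0, ..., 0 makes [A] disjoint
   from all the blocks whose indices sum to 0. *)
Lemma latin_avoidable_small_projections (B : finZmodType) (H : finType) (b : B)
    (i0 : I) (A : {set {ffun I -> B * H}}) :
    b != 0%R -> (forall i, #|projection i A| <= #|H|) ->
  latin_avoidable A.
Proof.
move=> b0 leA; pose target i := if i == i0 then b else 0%R.
pose class x := [set a : B * H | a.1 == x].
have card_class x : #|class x| = #|H|.
  have -> : class x = setX [set x] [set: H].
    by apply/setP => a; rewrite !inE andbT.
  by rewrite cardsX cards1 cardsT mul1n.
have /fin_all_exists2[f f_bij fP] i : exists2 f : B * H -> B * H,
    bijective f & f @^-1: projection i A \subset class (target i).
  by apply: bij_preimset_sub; rewrite card_class.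
apply: (latin_avoidable_relabel f_bij).
apply: (latin_avoidable_blocks (@latin_zero_sum I B)) => x.
rewrite inE => /eqP x0.
suff -> : block (relabel f @^-1: A) x = set0 by apply: latin_avoidable0.
apply/setP => h; rewrite !inE; apply/negP => hA.
have x_target i : x i = target i.
  have /subsetP/(_ (x i, h i)) := fP i; rewrite !inE => /(_ _)/eqP; apply.
  by apply/imsetP; eexists; [exact: hA|rewrite !ffunE].
move/eqP: b0; apply; rewrite -x0 (bigD1 i0) //= x_target /target eqxx.
rewrite big1 ?addr0 // => i /negPf i_i0.
by rewrite x_target /target i_i0.
Qed.

Lemma projection_block_sub (B : finZmodType) (H : finType)
    (A : {set {ffun I -> B * H}}) (r : {ffun I -> {ffun H -> B}}) i s b :
  projection i (block (twist_point (line i r s) @^-1: A) b)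
    \subset fiber (twist s @^-1:
      \bigcup_h trace A i (twist_point r (pair_point b h))) (b i).
Proof.
apply/subsetP => _ /imsetP[h + ->]; rewrite !inE => hA.
apply/bigcupP; exists h => //; rewrite inE.
rewrite (_ : line _ _ _ = twist_point (line i r s) (pair_point b h)) //.
by apply/ffunP => j; rewrite !ffunE; case: eqP => // ->.
Qed.

Lemma card_large_projection (B : finZmodType) (H : finType)
    (A : {set {ffun I -> B * H}}) i b m g :
    codegree_le m A ->
  #|[set r : {ffun I -> {ffun H -> B}} |
      g <= #|projection i (block (twist_point r @^-1: A) b)|]| * #|B| ^ g
    <= 'C(#|H|, g) * (#|H| ^ #|I| * m) ^ g * #|{ffun I -> {ffun H -> B}}|.
Proof.
move=> leA; apply: (@card_le_trace _ _ _ i) => r.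
set D := \bigcup_h trace A i (twist_point r (pair_point b h)).
have leD : #|D| <= #|H| ^ #|I| * m.
  rewrite -card_ffun -sum_nat_const; apply: leq_trans (leq_card_bigcup _ _) _.
  by apply: leq_sum => h _; apply: leA.
apply: (@leq_trans ('C(#|H|, g) * #|D| ^ g * #|{ffun H -> B}|)); last first.
  by rewrite leq_mul2r leq_mul2l leq_exp2rW ?orbT.
apply: leq_trans (card_large_fiber D (b i) g).
rewrite leq_mul2r subset_leq_card ?orbT //.
apply/subsetP => s; rewrite !inE => /leq_trans; apply.
exact/subset_leq_card/projection_block_sub.
Qed.

Lemma all_avoidable_sparse (i0 : I) (B : finZmodType) (H : finType) m :
    #|I| * #|B| ^ #|I| *
      ('C(2 * #|H|, #|H|.+1) * ((2 * #|H|) ^ #|I| * m) ^ #|H|.+1)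
      < #|B| ^ #|H|.+1 ->
  all_avoidable I (B * (bool * H))%type m.
Proof.
move=> lt_B A leA.
have B0 : 0 < #|B| by apply/card_gt0P; exists 0%R.
pose bad (e : I * {ffun I -> B}) := [set r : {ffun I -> {ffun bool * H -> B}} |
  #|H| < #|projection e.1 (block (twist_point r @^-1: A) e.2)|].
have [|||r rP] := union_bound (bad := bad) (q := #|B| ^ #|H|.+1)
    (p := 'C(2 * #|H|, #|H|.+1) * ((2 * #|H|) ^ #|I| * m) ^ #|H|.+1).
- by rewrite !card_ffun !expn_gt0 B0.
- by rewrite card_prod card_ffun.
- move=> [i b]; have := card_large_projection i b #|H|.+1 leA.
  by rewrite card_prod card_bool.
apply: (latin_avoidable_twist (r := r)) => b.
apply: (@latin_avoidable_small_projections _ _ true i0) => // i.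
by have := rP (i, b); rewrite inE -leqNgt.
Qed.

End Avoidance.

Lemma poly_le_exp2 C k : exists N, forall n, N <= n -> C * n ^ k <= 2 ^ n.
Proof.
have pow_le n : n ^ k.+1 <= k.+1 ^ k.+1 * 2 ^ n.
  have le_n : n <= k.+1 * 2 ^ (n %/ k.+1).
    apply: leq_trans (ltnW (ltn_ceil n (ltn0Sn k))) _.
    by rewrite mulnC leq_mul2l ltn_expl.
  apply: leq_trans (leq_exp2rW k.+1 le_n) _.
  by rewrite expnMn -expnM leq_mul2l leq_pexp2l ?orbT ?leq_divM.
exists (C * k.+1 ^ k.+1) => n le_n.
rewrite -(@leq_pmul2l (k.+1 ^ k.+1)) ?expn_gt0 // mulnA [_ * C]mulnC.
by apply: leq_trans (pow_le n); rewrite [n ^ k.+1]expnS leq_mul2r le_n orbT.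
Qed.

Section LinearDensity.

Variables (I : finType) (i0 : I).

Lemma all_avoidable_sparse_pow2 :
  exists s e, forall c, all_avoidable I 'I_(2 ^ (s.+1 * c + e)) (2 ^ c).
Proof.
pose d := #|I|; pose g := (2 ^ d).+1.
pose N := d * ('C(2 * 2 ^ d, g) * ((2 * 2 ^ d) ^ d) ^ g).
exists (2 ^ d), (N + d.+1) => c; rewrite -/g; set a := g * c + N.
pose V : finType := ('I_(2 ^ a).-1.+1 * (bool * {ffun I -> bool}))%type.
have card_a : #|'I_(2 ^ a).-1.+1| = 2 ^ a by rewrite card_ord prednK ?expn_gt0.
have card_H : #|{ffun I -> bool}| = 2 ^ d by rewrite card_ffun card_bool.
apply: (@all_avoidable_card _ V).
  by rewrite !card_prod card_a card_H card_bool card_ord addnA expnD expnS.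
apply: all_avoidable_sparse => //; rewrite card_a card_H -/d -/g.
have -> : d * (2 ^ a) ^ d * ('C(2 * 2 ^ d, g) * ((2 * 2 ^ d) ^ d * 2 ^ c) ^ g) =
    (2 ^ a) ^ d * (N * 2 ^ (g * c)).
  by rewrite expnMn [g * c]mulnC expnM /N; ring.
apply: (@leq_trans ((2 ^ a) ^ d.+1)).
  rewrite expnSr ltn_pmul2l ?expn_gt0 // /a addnC expnD ltn_pmul2r ?expn_gt0 //.
  exact: ltn_expl.
by rewrite leq_pexp2l ?expn_gt0 // ltnS ltnW // ltn_expl.
Qed.

(* From this [m] on, the loss in [2 * m] incurred by the union bound over all
   lines is at most [2 * m / t.+1 ^ 2]. *)
Definition halving_threshold t := 2 * t.+1 ^ 4 * (#|I| * t.+1 + 3).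

Lemma all_avoidable_halving_pow2 t m :
    halving_threshold t <= m -> all_avoidable I 'I_(2 ^ t) m ->
  exists2 m', all_avoidable I 'I_(2 ^ t.+1) m' &
    2 * m * (t * t.+2) <= t.+1 ^ 2 * m'.
Proof.
rewrite /halving_threshold; set x := t.+1 => le_m avoid_m.
pose q := 2 * x ^ 2; pose h := 2 * x ^ 4; pose w := #|I| * x + 2.
pose v := (m %/ h).+1; pose loss := q * (v + w).
have x2_gt0 : 0 < x ^ 2 by rewrite expn_gt0.
have h_gt0 : 0 < h by rewrite muln_gt0 expn_gt0.
have le_loss : x ^ 2 * loss <= 2 * m.
  have -> : x ^ 2 * loss = m %/ h * h + h * (#|I| * x + 3).
    by rewrite /loss /q /v /w /h; ring.
  by have := leq_divM m h; rewrite -/h in le_m; lia.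
exists (2 * m - loss); last first.
  have -> : t * t.+2 = x ^ 2 - 1 by rewrite /x; lia.
  by rewrite mulnBr mulnBr muln1 [_ * x ^ 2]mulnC leq_sub2l.
apply: (@all_avoidable_card _ (bool * 'I_(2 ^ t))%type).
  by rewrite card_prod card_bool !card_ord expnS.
apply: (all_avoidable_halving (q := q) (h := h) (v := v) (w := w)) avoid_m.
- by rewrite muln_gt0.
- by rewrite /q /h; lia.
- by rewrite mulnC ltnW // ltn_ceil.
- by rewrite subnK //; apply: leq_trans le_loss; rewrite leq_pmull.
- rewrite card_ffun card_prod card_bool card_ord -expnS -expnM -expnSr /w mulnC.
  by rewrite ltn_exp2l // addn2.
Qed.

(* The product of the factors [1 - 1 / (t + 1) ^ 2 = t (t + 2) / (t + 1) ^ 2]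
   telescopes. *)
Lemma all_avoidable_density_step K t m :
    halving_threshold t <= m -> all_avoidable I 'I_(2 ^ t) m ->
    t.+1 * 2 ^ t <= K * t * m ->
  exists2 m', all_avoidable I 'I_(2 ^ t.+1) m' &
    t.+2 * 2 ^ t.+1 <= K * t.+1 * m'.
Proof.
move=> le_m avoid_m dens.
have [m' avoid_m' le_m'] := all_avoidable_halving_pow2 le_m avoid_m.
exists m' => //.
rewrite -(@leq_pmul2l (t.+1 ^ 2)) ?expn_gt0 //.
apply: (@leq_trans (K * t.+1 * (2 * m * (t * t.+2)))); last first.
  by rewrite [leqRHS]mulnCA leq_mul2l le_m' orbT.
have -> : t.+1 ^ 2 * (t.+2 * 2 ^ t.+1) = 2 * t.+1 * t.+2 * (t.+1 * 2 ^ t).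
  by rewrite [2 ^ t.+1]expnS; ring.
have -> : K * t.+1 * (2 * m * (t * t.+2)) = 2 * t.+1 * t.+2 * (K * t * m).
  by ring.
by rewrite leq_mul2l dens orbT.
Qed.

Lemma all_avoidable_density K t0 m0 :
    0 < t0 ->
    (forall t m, t0 <= t -> 2 ^ t <= K * m -> halving_threshold t <= m) ->
    all_avoidable I 'I_(2 ^ t0) m0 -> t0.+1 * 2 ^ t0 <= K * t0 * m0 ->
  forall t, t0 <= t -> exists2 m, all_avoidable I 'I_(2 ^ t) m & 2 ^ t <= K * m.
Proof.
move=> t0_gt0 large avoid_m0 dens0.
have weaken t m : t0 <= t -> t.+1 * 2 ^ t <= K * t * m -> 2 ^ t <= K * m.
  move=> le_t dens; rewrite -(@leq_pmul2l t) ?(leq_trans t0_gt0) //.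
  by rewrite mulnCA mulnA; apply: leq_trans dens; rewrite leq_mul2r leqnSn orbT.
suff step t : t0 <= t ->
    exists2 m, all_avoidable I 'I_(2 ^ t) m & t.+1 * 2 ^ t <= K * t * m.
  by move=> t le_t; have [m ? /(weaken _ _ le_t)] := step t le_t; exists m.
move=> /subnKC<-; elim: (t - t0) => [|j [m avoid_m dens]].
  by exists m0; rewrite addn0.
rewrite addnS; apply: (all_avoidable_density_step _ avoid_m dens).
by apply: large (leq_addr _ _) (weaken _ _ (leq_addr _ _) dens).
Qed.

Lemma all_avoidable_eventual_density :
  exists t0 K, 0 < K /\ forall t, t0 <= t ->
    exists2 m, all_avoidable I 'I_(2 ^ t) m & 2 ^ t <= K * m.
Proof.
have [s [e avoid0]] := all_avoidable_sparse_pow2.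
have [c0 poly_le] := poly_le_exp2 (4 * (#|I| + 3) * (s + e + 2) ^ 5) 5.
pose c := c0.+1; pose t0 := s.+1 * c + e; pose K := 2 ^ (t0 - c).+1.
have le_ct0 : c <= t0 by rewrite /t0; lia.
have large t m : t0 <= t -> 2 ^ t <= K * m -> halving_threshold t <= m.
  move=> /subnKC; move: (t - t0) => j def_t.
  have -> : 2 ^ t = K * 2 ^ (c0 + j) by rewrite -expnD; congr (2 ^ _); lia.
  rewrite leq_pmul2l ?expn_gt0 //; apply: leq_trans.
  have le_t : t.+1 <= (s + e + 2) * (c + j) by rewrite -def_t /t0 /c; nia.
  rewrite -(@leq_pmul2l 2) // -expnS -addSn -/c /halving_threshold.
  apply: leq_trans (poly_le (c + j) (leq_trans (leqnSn _) (leq_addr _ _))).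
  rewrite -[leqRHS]mulnA -expnMn.
  apply: leq_trans (leq_mul (leqnn _) (leq_exp2rW 5 le_t)).
  by rewrite [t.+1 ^ 5]expnS; move: (t.+1 ^ 4) => y; nia.
exists t0, K; split; first by rewrite expn_gt0.
apply: all_avoidable_density large (avoid0 c) _; first by rewrite /t0 /c; lia.
rewrite mulnAC -expnD (_ : (t0 - c).+1 + c = t0.+1); last by lia.
by rewrite expnS mulnAC leq_mul2r; apply/orP; right; lia.
Qed.

Theorem all_avoidable_linear :
  exists2 K, 0 < K & forall t m, K * m <= 2 ^ t -> all_avoidable I 'I_(2 ^ t) m.
Proof.
have [t0 [K [K_gt0 density]]] := all_avoidable_eventual_density.
exists (K * 2 ^ t0) => [|t m le_m]; first by rewrite muln_gt0 K_gt0 expn_gt0.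
have [le_t0t|lt_tt0] := leqP t0 t.
  have [m' avoid_m' le_m'] := density t le_t0t.
  apply: all_avoidableW avoid_m'; rewrite -(leq_pmul2l K_gt0).
  apply: leq_trans (leq_trans le_m le_m').
  by rewrite leq_mul2r leq_pmulr ?expn_gt0 ?orbT.
have -> : m = 0; last exact: all_avoidable0.
apply/eqP; rewrite -leqn0 leqNgt; apply/negP => m_gt0.
have: 2 ^ t0 <= 2 ^ t.
  by apply: leq_trans le_m; rewrite mulnAC leq_pmull // muln_gt0 K_gt0.
by rewrite leq_exp2l // leqNgt lt_tt0.
Qed.

End LinearDensity.

Section CubeGraph.

Variable n : nat.
Implicit Types (A : cube n) (i j k s : 'I_n).

Definition point4 i j k s : {ffun 'I_4 -> 'I_n} :=
  [ffun x : 'I_4 => nth s [:: i; j; k] x].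

Definition cube_graph A : {set {ffun 'I_4 -> 'I_n}} :=
  [set p : {ffun 'I_4 -> 'I_n} | p 3 \in A (p 0) (p 1) (p 2)]%R.

Lemma line_point4 i j k s u :
  [/\ line 0%R (point4 i j k s) u = point4 u j k s,
      line 1%R (point4 i j k s) u = point4 i u k s,
      line 2%R (point4 i j k s) u = point4 i j u s &
      line 3%R (point4 i j k s) u = point4 i j k u].
Proof. by split; apply/ffunP => -[[|[|[|[|//]]]] ltx]; rewrite !ffunE. Qed.

Lemma codegree_le_cube_graph m A :
  mmmm_cube m A -> codegree_le m (cube_graph A).
Proof.
move=> [le_symbol [le_row [le_column le_file]]] x p.
case: x => [[|[|[|[|//]]]] ltx].
- have := le_column (p 3%R) (p 1%R) (p 2%R); apply/leq_trans/subset_leq_card.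
  by apply/subsetP => u; rewrite !inE !ffunE.
- have := le_row (p 3%R) (p 0%R) (p 2%R); apply/leq_trans/subset_leq_card.
  by apply/subsetP => u; rewrite !inE !ffunE.
- have := le_file (p 3%R) (p 0%R) (p 1%R); apply/leq_trans/subset_leq_card.
  by apply/subsetP => u; rewrite !inE !ffunE.
- have := le_symbol (p 0%R) (p 1%R) (p 2%R); apply/leq_trans/subset_leq_card.
  by apply/subsetP => u; rewrite !inE !ffunE.
Qed.

Lemma avoidable_of_cube_graph A : latin_avoidable (cube_graph A) -> avoidable A.
Proof.
move=> [G latG disjG].
have unique i j k : exists s, forall s', (s == s') = (point4 i j k s' \in G).
  have /eqP/cards1P[s sP] := latG 3%R (point4 i j k i); exists s => s'.
  have [_ _ _ <-] := line_point4 i j k i s'.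
  by rewrite eq_sym -in_set1 -sP inE.
have [L LP] := fin_all_exists (fun i => fin_all_exists (fun j =>
  fin_all_exists (unique i j))).
have card_line x (Q : pred 'I_n) p :
    (forall u, Q u = (line x p u \in G)) -> #|[set u | Q u]| = 1.
  by move=> QP; rewrite -(latG x p); apply: eq_card => u; rewrite !inE QP.
exists L; split; last first.
  move=> i j k; apply: contraFN (pred0P disjG (point4 i j k (L i j k))) => sA.
  by rewrite /= -LP eqxx inE !ffunE.
split; [|split] => s u v.
- apply: (card_line 1%R _ (point4 u u v s)) => j; rewrite LP.
  by have [_ <-] := line_point4 u u v s j.
- apply: (card_line 0%R _ (point4 u u v s)) => i; rewrite LP.
  by have [<-] := line_point4 u u v s i.
- apply: (card_line 2%R _ (point4 u v v s)) => k; rewrite LP.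
  by have [_ _ <-] := line_point4 u v v s k.
Qed.

End CubeGraph.

Theorem theorem1 :
  exists gamma : rat, (0 < gamma)%R /\
    forall (t m : nat), (30 <= t)%N -> (m%:R <= gamma * (2 ^ t)%:R)%R ->
      forall A : cube (2 ^ t), mmmm_cube m A -> avoidable A.
Proof.
have [K K_gt0 linear] := all_avoidable_linear (0%R : 'I_4).
exists (K%:R^-1)%R; split; first by rewrite invr_gt0 ltr0n.
move=> t m _ le_m A /codegree_le_cube_graph leA.
apply/avoidable_of_cube_graph/(linear t m) => //.
by rewrite mulrC ler_pdivlMr ?ltr0n // -natrM ler_nat mulnC in le_m.
Qed.
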